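(* For every integer $n>1$, the second player wins (under perfect play) the No-Factor game starting from the integers $1,2,\dots,n$.
   Context: No-Factor game: the integers $1$ through $n$ are written out. Two players alternate turns. On a turn, a player removes a non-empty set of the remaining numbers such that no number removed has a proper factor among the numbers remaining at the beginning of that turn. A proper factor of $x$ is a positive divisor $d$ of $x$ with $d<x$ (in particular $1$ is a proper factor of every $x>1$). The player who does not have a move loses. *)

(* Defs.v *)
From mathcomp Require Import all_boot.
Set Implicit Arguments. Unset Strict Implicit. Unset Printing Implicit Defensive.

(* Normal-play outcomes of a two-player impartial game with move relation
   [move]: "first" is the player about to move, "second" the other one.  The
   definition being inductive, a win is forced in finitely many turns, and
   [second_wins p] holds in particular when no move is available at [p]. *)
Inductive first_wins (T : Type) (move : T -> T -> Prop) (p : T) : Prop :=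
| FirstWins q of move p q & second_wins move q
with second_wins (T : Type) (move : T -> T -> Prop) (p : T) : Prop :=
| SecondWins of (forall q, move p q -> first_wins move q).

Definition proper_factor (d x : nat) : bool := [&& 0 < d, d %| x & d < x].

(* A position of the game on 1, ..., n is the set of remaining numbers; it
   lives in the ordinals 0, ..., n, where 0 is never part of a position
   reachable from [no_factor_start n]. *)
Definition no_factor_start (n : nat) : {set 'I_n.+1} := [set x : 'I_n.+1 | 0 < x].

Definition no_factor_move (n : nat) (A B : {set 'I_n.+1}) : Prop :=
  exists S : {set 'I_n.+1},
    [/\ S != set0, S \subset A,
        forall x d : 'I_n.+1, x \in S -> d \in A -> ~~ proper_factor d x
      & B = A :\: S].

(* Main.v *)
Require Import Defs.
From mathcomp Require Import all_boot.
From mathcomp Require Import zify.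

(** The first turn is forced: 1 is a proper factor of everything else, so only
    1 can be removed, and the second player then moves on 2, ..., n.  That
    player wins by strategy stealing.  Let p be a prime with p <= n < p ^ 2.
    Removing p exposes nothing: a proper multiple p * m <= n has 1 < m < p, so
    its factor m remains.  Hence if S is a legal move after {p} has been
    removed, then {p} together with S is already legal before.  Now either
    removing p alone wins, or the opponent has a winning reply S, and removing
    {p} together with S reaches the very position that this reply would have
    reached ([steal_first_wins]).

    The arithmetic input is a prime between sqrt n and n, a weak form of
    Bertrand's postulate with a short proof in the style of Erdos
    ([prime_above_sqrt]).  By Legendre's formula a prime power dividing the
    binomial 'C(n, n./2) is at most n.  If every prime up to n were at most
    s = floor (sqrt n), then that binomial would be at most n ^ s; but it is at
    least 2 ^ n./2, which is larger as soon as s >= 19.  The four primes 2, 3,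
    7 and 47 settle n < 47 ^ 2. *)

(** * A prime between the square root of n and n *)

(** By Legendre's formula the left side is the sum over [k] of
    [n %/ p ^ k - m %/ p ^ k - (n - m) %/ p ^ k], which is the carry out of the
    [k] lowest digits when [m] and [n - m] are added in base [p].  A carry is at
    most 1, and there is none once [p ^ k > n], that is for
    [k > trunc_log p n]. *)
Lemma logn_bin_le {p n m} : prime p -> m <= n ->
  logn p 'C(n, m) <= trunc_log p n.
Proof.
move=> pp le_mn; have p_gt1 := prime_gt1 pp.
have := congr1 (logn p) (bin_fact le_mn).
rewrite !lognM ?muln_gt0 ?fact_gt0 ?bin_gt0 // !logn_fact //.
have extend a : a <= n ->
    \sum_(1 <= k < a.+1) a %/ p ^ k = \sum_(1 <= k < n.+1) a %/ p ^ k.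
  move=> le_an; rewrite [RHS](big_cat_nat (n := a.+1)) //=.
  rewrite [X in _ = _ + X]big_nat_cond [X in _ = _ + X]big1 ?addn0 //.
  move=> k /andP[/andP[lt_ak _] _].
  rewrite divn_small //; exact: ltn_trans lt_ak (ltn_expl k p_gt1).
rewrite (extend m) // (extend (n - m)) ?leq_subr // -big_split /= => eq_log.
have carry : \sum_(1 <= k < n.+1) n %/ p ^ k <=
    \sum_(1 <= k < n.+1) (m %/ p ^ k + (n - m) %/ p ^ k) +
    \sum_(1 <= k < n.+1) (k <= trunc_log p n).
  rewrite -big_split /=; apply: leq_sum => k _.
  have pk_gt0 : 0 < p ^ k by rewrite expn_gt0 ltnW.
  have [|lt_log_k] := leqP k (trunc_log p n).
    move=> _; rewrite -{1}(subnKC le_mn) divnD //.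
    by rewrite leq_add2l leq_b1.
  by rewrite divn_small // (leq_trans (trunc_log_ltn n p_gt1)) ?leq_exp2l.
suff : \sum_(1 <= k < n.+1) (k <= trunc_log p n) <= trunc_log p n by lia.
have -> : \sum_(1 <= k < n.+1) (k <= trunc_log p n) =
          \sum_(k <- index_iota 1 n.+1 | k <= trunc_log p n) 1.
  by rewrite [RHS]big_mkcond; apply: eq_bigr => k _; case: leqP.
rewrite sum1_count -size_filter -[leqRHS](size_iota 1).
apply: uniq_leq_size => [|k]; first by rewrite filter_uniq ?iota_uniq.
by rewrite mem_filter mem_index_iota mem_iota; lia.
Qed.

(** Each prime contributes to the factorization a prime power at most [n]. *)
Lemma bin_le_expn_primes {n m} : m <= n ->
  'C(n, m) <= n ^ size (primes 'C(n, m)).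
Proof.
case: n => [|n] le_mn; first by case: m le_mn.
have bin_pos : 0 < 'C(n.+1, m) by rewrite bin_gt0.
rewrite {1}[X in X <= _]prod_prime_decomp // prime_decompE big_map /=.
rewrite -count_predT -iter_muln_1 -big_const_seq big_seq [leqRHS]big_seq.
apply: leq_prod => p; rewrite mem_primes => /andP[pp _].
have p_gt1 := prime_gt1 pp; apply: leq_trans (trunc_logP p_gt1 (ltn0Sn n)).
by rewrite leq_exp2l // logn_bin_le.
Qed.

Lemma expn2_le_bin {n m} : m.*2 <= n -> 2 ^ m <= 'C(n, m).
Proof.
elim: m n => [|m IHm] n le_mn; first by rewrite bin0.
case: n le_mn => // n le_mn.
rewrite expnS -(leq_pmul2l (ltn0Sn m)) -mul_bin_diag.
by rewrite mulnA leq_mul ?IHm //; lia.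
Qed.

(** The bound that makes [2 ^ (s ^ 2)] beat [s.+1 ^ (4 * s)], after raising both
    sides to the power [s]. *)
Lemma expn4_le_expn2 {s} : 18 < s -> 2 * s.+1 ^ 4 <= 2 ^ s.
Proof.
elim: s => // s IHs; rewrite leq_eqVlt => /predU1P[<- |s_gt18]; first by lia.
have {IHs} := IHs s_gt18.
rewrite (expnS 2 s) !(expnM _ 2 2).
(* Squaring this ratio bound gives [s.+2 ^ 4 <= 2 * s.+1 ^ 4], as 49 < 50. *)
have : 5 * s.+2 ^ 2 <= 7 * s.+1 ^ 2 by nia.
move: (s.+2 ^ 2) (s.+1 ^ 2) (2 ^ s) => x y z; nia.
Qed.

Lemma prime_above_sqrt {n} : 1 < n -> exists2 p, prime p & p <= n < p ^ 2.
Proof.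
move=> n_gt1.
(* 3 < 2 ^ 2, 7 < 3 ^ 2 and 47 < 7 ^ 2, so the intervals from [p] to [p ^ 2]
   for these four primes cover every [n < 47 ^ 2]. *)
have [n_small|n_ge9] := ltnP n 9.
  have [n_lt4|n_ge4] := ltnP n 4; first by exists 2; rewrite ?n_gt1.
  by exists 3; rewrite ?n_small ?andbT ?(ltnW n_ge4).
have [n_lt49|n_ge49] := ltnP n 49.
  by exists 7; rewrite ?n_lt49 ?andbT // (leq_trans _ n_ge9).
have [n_lt|n_ge] := ltnP n (47 ^ 2).
  by exists 47; rewrite ?n_lt ?andbT // (leq_trans _ n_ge49).
have [/existsP[p /andP[pp n_lt]]|/existsPn no_p] :=
  boolP [exists p : 'I_n.+1, prime p && (n < p ^ 2)].
  by exists p => //; rewrite n_lt -ltnS ltn_ord.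
have bound_sqrt i : i ^ 2 <= n -> i <= n by nia.
case: (ex_maxnP (ex_intro (fun i => i ^ 2 <= n) 0 isT) bound_sqrt).
move=> s le_s2n s_max; have {n_ge} s_ge47 := s_max 47 n_ge.
have s_gt0 : 0 < s by lia.
have n_lt : n < s.+1 ^ 2.
  by rewrite ltnNge; apply/negP => /s_max; rewrite ltnn.
set N := 'C(n, n./2).
have half_le : n./2 <= n by lia.
have few_primes : size (primes N) <= s.
  rewrite -(size_iota 1 s); apply: uniq_leq_size (primes_uniq N) _ => p.
  move=> p_in; have := p_in; rewrite mem_primes => /and3P[pp _ _].
  have: 0 < trunc_log p n.
    by apply: leq_trans _ (logn_bin_le pp half_le); rewrite logn_gt0.
  rewrite trunc_log_gt0 => /andP[p_gt1 lt_pn].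
  have lt_pn1 : p < n.+1 by lia.
  have := no_p (Ordinal lt_pn1); rewrite /= pp -leqNgt => /s_max.
  by rewrite mem_iota; lia.
have le_N : 2 ^ n./2 <= s.+1 ^ (2 * s).
  have half2_le : n./2.*2 <= n by lia.
  apply: leq_trans (expn2_le_bin half2_le) _.
  apply: leq_trans (bin_le_expn_primes half_le) _.
  apply: leq_trans (leq_pexp2l _ few_primes) _; first by lia.
  by rewrite expnM leq_exp2r // ltnW.
(* Squaring clears the halving of the exponent; the factor 2 pays for odd [n]. *)
have lower : 2 ^ n <= 2 * (2 ^ n./2) ^ 2.
  by rewrite -expnM -expnS leq_pexp2l //; lia.
have upper : (2 ^ n./2) ^ 2 <= s.+1 ^ (4 * s).
  by rewrite (_ : 4 * s = 2 * s * 2) 1?expnM ?leq_sqr //; lia.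
have strong : 2 ^ s * s.+1 ^ (4 * s) <= 2 ^ n.
  rewrite expnM -expnMn (leq_trans (n := (2 ^ s) ^ s)) //.
    by rewrite leq_exp2r // expn4_le_expn2 //; lia.
  by rewrite -expnM leq_pexp2l // mulnn.
have two_s : 2 ^ 2 <= 2 ^ s by rewrite leq_pexp2l //; lia.
have pos : 0 < s.+1 ^ (4 * s) by rewrite expn_gt0.
nia.
Qed.

(** * Strategy stealing *)

Definition legal {n : nat} (A S : {set 'I_n.+1}) : bool :=
  [&& S != set0, S \subset A &
      [forall x in S, [forall d in A, ~~ proper_factor d x]]].

Lemma no_factor_moveP {n} (A B : {set 'I_n.+1}) :
  no_factor_move A B <-> exists2 S, legal A S & B = A :\: S.
Proof.
split=> [[S [S0 sSA min_S ->]]|[S /and3P[S0 sSA /forall_inP min_S] ->]].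
  exists S => //; apply/and3P; split=> //.
  by apply/forall_inP => x xS; apply/forall_inP => d; apply: min_S.
by exists S; split=> // x d /min_S/forall_inP; apply.
Qed.

(** The outcomes are inductive propositions, not booleans, so the choice
    between a winning move and the absence of one is made by [fin_all_exists]
    over the finitely many candidate sets, without excluded middle. *)
Lemma no_factor_determined {n} (A : {set 'I_n.+1}) :
  first_wins (@no_factor_move n) A \/ second_wins (@no_factor_move n) A.
Proof.
have [k] := ubnP #|A|; elim: k A => // k IHk A lt_Ak.
have /fin_all_exists[win winP] : forall S, exists b : bool,
    if b then legal A S /\ second_wins (@no_factor_move n) (A :\: S)
    else legal A S -> first_wins (@no_factor_move n) (A :\: S).
  move=> S; have [legS|] := boolP (legal A S); last by exists false.
  have /IHk[] : #|A :\: S| < k; [|by exists false|by exists true].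
  have /and3P[S0 sSA _] := legS; rewrite -card_gt0 in S0.
  by have := subset_leq_card sSA; rewrite cardsDS //; lia.
have [/existsP[S winS]|/existsPn no_win] := boolP [exists S, win S].
  have := winP S; rewrite winS => -[legS sw]; left.
  by apply: FirstWins sw; apply/no_factor_moveP; exists S.
right; constructor=> B /no_factor_moveP[S legS ->].
by have := winP S; rewrite (negbTE (no_win S)); apply.
Qed.

(** The factor [d] different from [p] says that removing [p] makes no other
    number removable.  A reply to the removal of [p] can thus be merged with
    it into a single move. *)
Lemma steal_first_wins {n} (A : {set 'I_n.+1}) (p : 'I_n.+1) :
    p \in A ->
    {in A, forall d : 'I_n.+1, ~~ proper_factor d p} ->
    {in A, forall x : 'I_n.+1, proper_factor p x ->
       exists2 d, d \in A :\ p & proper_factor d x} ->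
  first_wins (@no_factor_move n) A.
Proof.
move=> pA min_p blocked.
have [[B /no_factor_moveP[S legS ->] sw]|sw] := no_factor_determined (A :\ p).
  apply: FirstWins sw; apply/no_factor_moveP; exists (p |: S); last first.
    by rewrite setDDl.
  have /and3P[_ /subsetP sSAp /forall_inP min_S] := legS.
  apply/and3P; split; first by apply/set0Pn; exists p; rewrite setU11.
    by rewrite subUset sub1set pA; apply/subsetP => x /sSAp/setD1P[].
  apply/forall_inP => x /setU1P[->|xS]; apply/forall_inP => d dA.
    exact: min_p.
  have [/setD1P[_ xA] /forall_inP free_x] := (sSAp x xS, min_S x xS).
  have [eq_dp|ne_dp] := eqVneq d p; last by rewrite free_x // !inE ne_dp.
  apply/negP; rewrite eq_dp => /(blocked x xA)[e eAp].
  exact/negP/free_x.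
apply: FirstWins sw; apply/no_factor_moveP; exists [set p] => //.
apply/and3P; split; first by apply/set0Pn; exists p; rewrite set11.
  by rewrite sub1set.
by apply/forall_inP => x /set1P->; apply/forall_inP.
Qed.

(** With [p] prime and [n < p ^ 2], a proper multiple of [p] keeps its cofactor
    when [p] disappears. *)
Lemma first_wins_from_2 {n} : 1 < n ->
  first_wins (@no_factor_move n) [set x : 'I_n.+1 | 1 < x].
Proof.
case/prime_above_sqrt => p pp /andP[le_pn lt_np2].
have p_gt1 := prime_gt1 pp.
apply: (@steal_first_wins _ _ (Ordinal (le_pn : p < n.+1))).
- by rewrite inE.
- move=> d; rewrite inE => d_gt1; apply/and3P => -[_ /= dv lt_dp].
  by move/primeP: pp => [_ /(_ d dv)]/orP[]/eqP eq_d; lia.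
move=> x; rewrite inE => x_gt1 /and3P[_ /= /dvdnP[m x_mp] lt_px].
have le_xn : x <= n by rewrite -ltnS ltn_ord.
have m_gt1 : 1 < m by nia.
have lt_mp : m < p by nia.
have lt_mn : m < n.+1 by lia.
exists (Ordinal lt_mn).
  by rewrite !inE m_gt1 andbT -val_eqE /= neq_ltn lt_mp.
by rewrite /proper_factor /= x_mp dvdn_mulr //; apply/andP; split; nia.
Qed.

Theorem lemma10 (n : nat) (hn : 1 < n) :
  second_wins (@no_factor_move n) (no_factor_start n).
Proof.
constructor=> B [S [/set0Pn[y yS] /subsetP sSA min_S ->]].
have lt_1n : 1 < n.+1 by lia.
(* The first player can only remove 1, a proper factor of all the others. *)
have only1 x : x \in S -> x = 1 :> nat.
  move=> xS; have := sSA x xS; rewrite inE => x_gt0.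
  have := min_S x (Ordinal lt_1n) xS; rewrite inE => /(_ isT).
  by rewrite /proper_factor /= dvd1n /=; lia.
suff -> : no_factor_start n :\: S = [set x : 'I_n.+1 | 1 < x].
  exact: first_wins_from_2.
apply/setP => x; rewrite !inE.
have [xS|xNS] /= := boolP (x \in S); first by rewrite (only1 x xS).
have : x != 1 :> nat.
  apply: contraNneq xNS => x1; suff -> : x = y by [].
  by apply: val_inj; rewrite /= x1 (only1 y yS).
lia.
Qed.
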